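(* Let $X$ be a separable Banach space and $T : X \to X$ a bounded linear operator which is surjective but not bijective. Assume that $0 < \dim(\mathrm{Ker}(T)) < +\infty$, that for each $n \in \mathbb{N}$ there is a decomposition $X = \mathrm{Ker}(T^n) \oplus E_n$ with $T(E_{n+1}) \subset E_n$ for each $n \in \mathbb{N}$, and that $\sum_{n=1}^{+\infty} p(T^n)^{-\alpha} < +\infty$, where $\alpha \in (0,1]$. Let $\nu$ be an a priori probability measure on $\mathrm{Ker}(T)$ with full support and strong adapted tails. For each bounded above potential $A \in \mathcal{H}_\alpha(X) \cap \mathcal{SV}_T(X)$, let $\lambda_A$ be the main eigenvalue of the Ruelle operator $\mathcal{L}_A$ and let $\mu_A$ be the Gibbs state associated with $A$. Then $$P_\nu(A) = \log(\lambda_A) = h_\nu(\mu_A) + \int_X A \, d\mu_A .$$ That is, the Gibbs state $\mu_A$ is also an equilibrium state for $A$.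
   Context: $\mathbb{N} = \{1,2,\dots\}$. $\|\cdot\|_X$ is the norm of $X$. For each $n$, $p(T^n) := \inf\{\|T^n(x)\|_X : \|x\|_X = 1,\ x \in E_n\}$. $\mathcal{C}(X)$ (resp. $\mathcal{C}_b(X)$) is the set of continuous (resp. bounded continuous) functions $X \to \mathbb{R}$. $\mathcal{H}_\alpha(X)$ is the set of $\varphi \in \mathcal{C}(X)$ with $\mathrm{Hol}^\alpha_\varphi := \sup_{x\neq y} |\varphi(x)-\varphi(y)|/\|x-y\|_X^\alpha < +\infty$; $\mathcal{H}_{b,\alpha}(X)$ is the set of bounded elements of $\mathcal{H}_\alpha(X)$. $\mathcal{SV}_T(X)$ is the set of $A \in \mathcal{C}(X)$ with summable variations: $V_T(A) := \sum_{n\ge1} V_{T,n}(A) < +\infty$, where $V_{T,n}(A) := \sup\{|A(z_n + x_n) - A(z_n + y_n)| : z_n \in \mathrm{Ker}(T^n),\ x_n, y_n \in E_n\}$. A priori measure: $\nu$ is a Borel probability measure on $\mathrm{Ker}(T)$ whose support is all of $\mathrm{Ker}(T)$. It has strong adapted tails if for every $\epsilon > 0$ there is a sequence of positive numbers $(\kappa_n)_{n\ge1} \in l^1(\mathbb{R})$ with $\sum_{n\ge1} \nu([-p(T^n)\kappa_n, p(T^n)\kappa_n]^c) < \epsilon$, where $[-r,r]^c$ denotes $\{z \in \mathrm{Ker}(T) : \|z\|_X > r\}$. Ruelle operator: for a bounded above $A \in \mathcal{H}_\alpha(X)$ and $\varphi \in \mathcal{C}_b(X)$, $\mathcal{L}_A(\varphi)(x)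 := \int_{\mathrm{Ker}(T)} e^{A(z+v)} \varphi(z+v)\, d\nu(z)$, where $v$ is any element of $T^{-1}(x)$. $\mathcal{L}_0$ is the operator for the potential $0$. The dual $\mathcal{L}_A^*$ acts on finite Borel measures by $\int \varphi\, d(\mathcal{L}_A^*\mu) = \int \mathcal{L}_A(\varphi)\, d\mu$ for $\varphi \in \mathcal{C}_b(X)$. For a bounded above $A \in \mathcal{H}_\alpha(X) \cap \mathcal{SV}_T(X)$ there are (Ruelle–Perron–Frobenius theorem) an eigenvalue $\lambda_A > 0$ (the main eigenvalue) and a strictly positive $\psi_A \in \mathcal{H}_{b,\alpha}(X)$ with $\mathcal{L}_A(\psi_A) = \lambda_A \psi_A$. The associated normalized potential is $\overline{A} := A + \log \psi_A - \log(\psi_A \circ T) - \log \lambda_A$, which satisfies $\mathcal{L}_{\overline{A}}(1) = 1$. The Gibbs state $\mu_A$ is the Borel ($T$-invariant) probability measure with $\mathcal{L}_{\overline{A}}^* \mu_A = \mu_A$, whose existence is given by the same theorem. $\mathcal{P}_T(X)$ is the set of $T$-invariant Borel probability measures on $X$. Entropy: for $\mu \in \mathcal{P}_T(X)$, $h_\nu(\mu) := \inf\{\int_X \log(\mathcal{L}_0(u)/u)\, d\mu : u \in \mathcal{C}_b(X),\ u > 0\}$. Pressure: $P_\nu(A) := \sup\{h_\nu(\mu) + \int_X A\, d\mu : \mu \in \mathcal{P}_T(X)\}$. An equilibrium state for $A$ is a $\widehat\mu \in \mathcal{P}_T(X)$ with $P_\nu(A) = h_\nu(\widehat\mu) + \int_X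 A\, d\widehat\mu$. *)

(* Defs.v *)
From HB Require Import structures.
From mathcomp Require Import all_boot all_order all_algebra.
From mathcomp Require Import all_classical all_reals all_analysis.

Set Implicit Arguments.
Unset Strict Implicit.
Unset Printing Implicit Defensive.

Import Order.TTheory GRing.Theory Num.Theory.
Import numFieldNormedType.Exports.

Local Open Scope classical_set_scope.
Local Open Scope ring_scope.

Definition separable_space (X : topologicalType) : Prop :=
  exists2 D : set X, countable D & dense D.

Notation borel X := (g_sigma_algebraType (@open X)).

Section linear_subspaces.
Context {R : realType} {X : lmodType R}.

Definition is_subspace (V : set X) : Prop :=
  V 0 /\ forall (a : R) x y, V x -> V y -> V (a *: x + y).

Definition has_dim (V : set X) (d : nat) : Prop :=
  exists b : 'I_d -> X,
    [/\ forall i, V (b i),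
        forall c : 'I_d -> R, \sum_i c i *: b i = 0 -> forall i, c i = 0 &
        forall x, V x -> exists c : 'I_d -> R, x = \sum_i c i *: b i].

(* Closedness of V is not required: for U = Ker(T^n), V = E_n it follows from
   p(T^n) > 0. *)
Definition direct_sum_decomposition (U V : set X) : Prop :=
  [/\ is_subspace U, is_subspace V, U `&` V = [set 0] &
      forall x, exists u w, [/\ U u, V w & x = u + w]].

End linear_subspaces.

Section kernel_space.
Context {R : realType} {X : normedModType R}.

Definition ker_pow (T : X -> X) (n : nat) : set X := [set x | iter n T x = 0].

(* Ker T as a topological space of its own, with the topology induced by X;
   it is pointed by 0 because [g_sigma_algebraType] wants a pointed type. *)
Definition kerT (T : {linear X -> X}) : Type := set_type (ker_pow T 1).

HB.instance Definition _ (T : {linear X -> X}) :=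
  Topological.copy (kerT T) (set_type (ker_pow T 1)).

Fact kerT_0 (T : {linear X -> X}) : 0 \in ker_pow T 1.
Proof. by rewrite inE /ker_pow /= linear0. Qed.

HB.instance Definition _ (T : {linear X -> X}) :=
  isPointed.Build (kerT T) (exist _ 0 (kerT_0 T)).

End kernel_space.

Section thermodynamic_formalism.
Context {R : realType} {X : completeNormedModType R}.
Implicit Types (T : {linear X -> X}) (E : nat -> set X) (A phi psi u : X -> R)
  (alpha lambda : R) (n : nat).

(* E n is only meaningful for n >= 1. *)
Definition p_pow T E n : R :=
  inf [set `|iter n T x| | x in [set x | E n x /\ `|x| = 1]].

(* The positivity clause renders the convention 0^(-alpha) = +oo, which is not
   the one of [powR]. *)
Definition summable_p_pow T E alpha : Prop :=
  (forall n, (0 < n)%N -> 0 < p_pow T E n) /\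
  (\sum_(1 <= n <oo) (p_pow T E n `^ (- alpha))%:E < +oo)%E.

Definition bounded_continuous phi : Prop :=
  continuous phi /\ [bounded phi x | x in [set: X]].

Definition hol_const alpha phi : \bar R :=
  ereal_sup [set (`|phi xy.1 - phi xy.2| / `|xy.1 - xy.2| `^ alpha)%:E
            | xy in [set xy : X * X | xy.1 != xy.2]].

Definition hoelder_fun alpha phi : Prop :=
  continuous phi /\ (hol_const alpha phi < +oo)%E.

Definition bounded_hoelder_fun alpha phi : Prop :=
  hoelder_fun alpha phi /\ [bounded phi x | x in [set: X]].

Definition level_variation T E A n : \bar R :=
  ereal_sup [set r | exists z x y,
    [/\ ker_pow T n z, E n x, E n y & r = (`|A (z + x) - A (z + y)|)%:E]].

Definition summable_variations T E A : Prop :=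
  continuous A /\ (\sum_(1 <= n <oo) level_variation T E A n < +oo)%E.

Definition full_support T (nu : probability (borel (kerT T)) R) : Prop :=
  forall U : set (kerT T), open U -> U !=set0 -> (0 < nu U)%E.

Definition strong_adapted_tails T E
    (nu : probability (borel (kerT T)) R) : Prop :=
  forall eps : R, 0 < eps -> exists kappa : nat -> R,
    [/\ forall n, (0 < n)%N -> 0 < kappa n,
        (\sum_(1 <= n <oo) (kappa n)%:E < +oo)%E &
        (\sum_(1 <= n <oo)
           nu [set z : kerT T | (p_pow T E n * kappa n < `|\val z|)%R]
         < eps%:E)%E].

(* A choice of one element v x of T^-1(x) for each x; since nu is not translation
   invariant, the Ruelle operator depends on it. Measurability is what
   makes the images of bounded continuous functions under the Ruelle operator
   measurable; for X = Ker(T) (+) E 1, the selection with values in E 1 is an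
   instance. *)
Definition preimage_selection T (v : X -> X) : Prop :=
  (forall x, T (v x) = x) /\
  measurable_fun [set: borel X] (v : borel X -> borel X).

Definition ruelle T (nu : probability (borel (kerT T)) R) (v : X -> X)
    A phi (x : X) : R :=
  \int[nu]_z (expR (A (\val z + v x)) * phi (\val z + v x)).

Definition main_eigenpair T (nu : probability (borel (kerT T)) R)
    (v : X -> X) alpha A lambda psi : Prop :=
  [/\ 0 < lambda, bounded_hoelder_fun alpha psi, forall x, 0 < psi x &
      forall x, ruelle nu v A psi x = lambda * psi x].

Definition normalized_potential T A lambda psi (x : X) : R :=
  A x + ln (psi x) - ln (psi (T x)) - ln lambda.

Definition invariant_probability T (mu : probability (borel X) R) : Prop :=
  forall B : set (borel X), measurable B -> mu (T @^-1` B) = mu B.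

Definition dual_fixed T (nu : probability (borel (kerT T)) R) (v : X -> X)
    A (mu : probability (borel X) R) : Prop :=
  forall phi, bounded_continuous phi ->
    (\int[mu]_x (phi x)%:E = \int[mu]_x (ruelle nu v A phi x)%:E)%E.

Definition gibbs_state T (nu : probability (borel (kerT T)) R) (v : X -> X)
    A lambda psi (mu : probability (borel X) R) : Prop :=
  invariant_probability T mu /\
  dual_fixed nu v (normalized_potential T A lambda psi) mu.

(* Excludes oo - oo, to which [integral] assigns the value -oo: for u not bounded
   away from 0, both parts of log (L_0 u / u) can have infinite integral, and
   the infimum defining the entropy ignores such u. *)
Definition integral_exists (mu : probability (borel X) R) (f : X -> R) : Prop :=
  (\int[mu]_x (EFin \o f)^\+ x < +oo)%E \/
  (\int[mu]_x (EFin \o f)^\- x < +oo)%E.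

Definition log_ratio T (nu : probability (borel (kerT T)) R) (v : X -> X)
    u (x : X) : R :=
  ln (ruelle nu v (fun=> 0) u x / u x).

Definition entropy T (nu : probability (borel (kerT T)) R) (v : X -> X)
    (mu : probability (borel X) R) : \bar R :=
  ereal_inf [set (\int[mu]_x (log_ratio nu v u x)%:E)%E
            | u in [set u | [/\ bounded_continuous u, forall x, 0 < u x &
                              integral_exists mu (log_ratio nu v u)]]].

Definition pressure T (nu : probability (borel (kerT T)) R) (v : X -> X)
    A : \bar R :=
  ereal_sup [set (entropy nu v mu + \int[mu]_x (A x)%:E)%E
            | mu in [set mu | invariant_probability T mu]].

Definition equilibrium_state T (nu : probability (borel (kerT T)) R)
    (v : X -> X) A (mu : probability (borel X) R) : Prop :=
  invariant_probability T mu /\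
  pressure nu v A = (entropy nu v mu + \int[mu]_x (A x)%:E)%E.

End thermodynamic_formalism.

(* Main.v *)
Require Import Defs.
From HB Require Import structures.
From mathcomp Require Import all_boot all_order all_algebra.
From mathcomp Require Import all_classical all_reals all_analysis.
From mathcomp Require Import measurable_realfun.
From mathcomp Require Import ring lra.
Import Order.TTheory GRing.Theory Num.Theory.
Import numFieldNormedType.Exports.
Import HBNNSimple.
Local Open Scope classical_set_scope.
Local Open Scope ring_scope.

Set Implicit Arguments.
Unset Strict Implicit.
Unset Printing Implicit Defensive.

(** Write L_0 for the Ruelle operator of the zero potential, Abar for the
    normalized potential, and L_A for the Ruelle operator of A.

    Upper bound.  The function u = exp(A) psi is bounded, continuous and
    positive, and L_0 u = L_A psi = lambda psi, so log(L_0 u / u) is exactly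
    log lambda - A.  Testing the entropy of any probability m against this u
    gives h(m) + int A dm <= log lambda ([entropy_add_le]).

    Lower bound at the Gibbs state mu.  For an admissible u put
      G_u = log(L_0 u) o T - log u + Abar.
    The duality int phi dmu = int L_Abar phi dmu gives int exp(- G_u) dmu <= 1
    ([integral_exp_normalized_le1]).  As exp(t) >= 1 + t, it follows that
    G_u >= 1 - exp(- G_u), a function whose integral is >= 0, and
      log(L_0 u / u) = (f - f o T) + G_u - Abar      with f = log(L_0 u).
    If the coboundary f - f o T integrates to 0, this yields
    int log(L_0 u / u) dmu >= - int Abar dmu = log lambda - int A dmu.

    Neither log psi nor log(L_0 u) has to be integrable.  What saves the
    argument is that, for an invariant probability, a coboundary bounded on one
    side by an integrable function is integrable and has integral 0
    ([integral_coboundary]).  This is used twice: with f = log psi, where the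
    bound comes from A being bounded above and from G_u for u = psi o T, which
    is Abar itself (this yields the integrability of A); and with
    f = log(L_0 u), where the positive part of log(L_0 u / u) may be assumed
    integrable: otherwise its negative part is, by admissibility of u, and the
    integral of log(L_0 u / u) is +oo ([gibbs_log_ratio_ge]).

    The duality holds by assumption for bounded continuous phi, whereas
    exp(- G_u) involves L_0 u o T, which is only Borel because the selection of
    preimages is.  But exp(- G_u) is the product of a continuous function and of
    a function of T x, and since every point of the fiber over x is sent to x
    by T, the duality extends to products phi * (g o T) with phi bounded
    continuous and g Borel ([gibbs_duality]): both sides are finite measures
    in g, and they agree on continuous functions. *)

(** * Images of measures with a density *)

Section weighted_pushforward.
Local Open Scope ereal_scope.
Context d d' (X : measurableType d) (Y : measurableType d') (R : realType).
Variables (mu : {measure set X -> \bar R}) (a : X -> Y) (f : X -> R).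
Hypotheses (ma : measurable_fun setT a) (mf : measurable_fun setT f)
  (f0 : forall x, (0 <= f x)%R).

(** The image under [a] of the measure with density [f]; the three proofs are
    arguments so that the measure structure can be inferred from the term. *)
Definition weighted_pushforward of measurable_fun setT a & measurable_fun setT f
  & (forall x, (0 <= f x)%R) :=
  fun B : set Y => \int[mu]_(x in a @^-1` B) (f x)%:E.

Local Notation m := (weighted_pushforward ma mf f0).

Let m0 : m set0 = 0.
Proof. by rewrite /m preimage_set0 integral_set0. Qed.

Let m_ge0 B : 0 <= m B.
Proof. by apply: integral_ge0 => x _; rewrite lee_fin. Qed.

Let m_sigma_additive : semi_sigma_additive m.
Proof.
move=> F mF tF mUF; rewrite /m /weighted_pushforward preimage_bigcup.
have mpre k : measurable (a @^-1` F k) by rewrite -[_ @^-1` _]setTI; exact: ma.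
rewrite ge0_integral_bigcup//.
- by apply: is_cvg_nneseries => n _ _; exact: m_ge0.
- by apply/measurable_EFinP; exact: measurable_funTS.
- by move=> x _; rewrite lee_fin.
- by apply/trivIsetP => i j _ _ ij; rewrite -preimage_setI;
  move/trivIsetP : tF => /(_ _ _ Logic.I Logic.I ij) ->; rewrite preimage_set0.
Qed.

HB.instance Definition _ := isMeasure.Build _ _ _ m m0 m_ge0 m_sigma_additive.

Lemma integral_weighted_pushforward (g : Y -> R) :
  measurable_fun setT g -> (forall y, (0 <= g y)%R) ->
  \int[m]_y (g y)%:E = \int[mu]_x (f x * g (a x))%:E.
Proof.
move=> mg g0.
have mg' : measurable_fun setT (EFin \o g) by exact/measurable_EFinP.
pose h := nnsfun_approx measurableT mg'.
have hg y : (h n y)%:E @[n --> \oo] --> (g y)%:E.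
  by apply: (cvg_nnsfun_approx measurableT mg') => // z _; rewrite lee_fin.
have ndh y : nondecreasing_seq (fun n => h n y).
  by move=> i j ij; exact/lefP/nd_nnsfun_approx.
have simple (s : {nnsfun Y >-> R}) :
    \int[m]_y (s y)%:E = \int[mu]_x (f x * s (a x))%:E.
  have mpre r : measurable (a @^-1` (s @^-1` [set r])).
    by rewrite -[_ @^-1` _]setTI; apply: ma => //; exact: measurable_funPTI.
  rewrite integralT_nnsfun sintegralE.
  rewrite (eq_integral (fun x => \sum_(r \in range s)
      (f x * (r * \1_(s @^-1` [set r]) (a x)))%:E)); last first.
    move=> x _; rewrite fsumEFin// [in LHS](fimfunE s) -mulr_fsumr//.
  rewrite ge0_integral_fsum//; last 2 first.
  - move=> r; apply/measurable_EFinP; apply: measurable_funM => //.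
    apply: measurable_funM => //.
    by apply: (measurableT_comp _ ma); exact: measurable_indic.
  - move=> r x _; rewrite lee_fin mulr_ge0//.
    have [r0|r0] := leP 0%R r; first by rewrite mulr_ge0.
    rewrite indicE; case: (boolP (_ \in _)) => [|_]; last by rewrite mulr0.
    by rewrite inE /= => sr; move: r0; rewrite -sr ltNge fun_ge0.
  apply: eq_fsbigr => r /[!inE] -[y _ sy].
  have r0 : (0 <= r)%R by rewrite -sy.
  rewrite /m /weighted_pushforward.
  rewrite -ge0_integralZl//=; last 2 first.
  - by apply/measurable_EFinP; exact: measurable_funTS.
  - by move=> x _; rewrite lee_fin.
  rewrite integral_mkcond.
  apply: eq_integral => x _; rewrite patchE indicE.
  have -> : (a x \in s @^-1` [set r]) = (x \in a @^-1` (s @^-1` [set r])).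
    by apply/idP/idP; rewrite !inE.
  by case: ifPn => _; rewrite ?mulr1 ?mulr0 ?mule0// -EFinM mulrC.
rewrite (eq_integral (fun y => limn (fun n => (h n y)%:E))); last first.
  by move=> y _; apply/esym/cvg_lim.
rewrite monotone_convergence//; last 3 first.
- by move=> n; exact/measurable_EFinP.
- by move=> n y _; rewrite lee_fin.
- by move=> y _ i j ij; rewrite lee_fin; exact: ndh.
under eq_fun do rewrite simple.
rewrite -monotone_convergence//; last 3 first.
- move=> n; apply/measurable_EFinP; apply: measurable_funM => //.
  exact: measurableT_comp.
- by move=> n x _; rewrite lee_fin mulr_ge0.
- by move=> x _ i j ij; rewrite lee_fin ler_wpM2l//; exact: ndh.
apply: eq_integral => x _; apply/cvg_lim => //.
under eq_fun do rewrite EFinM.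
by rewrite EFinM; apply: cvgeZl.
Qed.

End weighted_pushforward.

(** * Coboundaries *)

Lemma integrable_between d (X : measurableType d) (R : realType)
    (mu : {measure set X -> \bar R}) (a f b : X -> R) :
  measurable_fun setT f -> (forall x, a x <= f x <= b x) ->
  mu.-integrable setT (EFin \o a) -> mu.-integrable setT (EFin \o b) ->
  mu.-integrable setT (EFin \o f).
Proof.
move=> mf afb inta intb.
have intab := integrableD measurableT (integrable_abse inta) (integrable_abse intb).
apply: (le_integrable measurableT _ _ intab); first exact/measurable_EFinP.
move=> x _; rewrite /= lee_fin [leRHS]ger0_norm ?addr_ge0//.
have /andP[af fb] := afb x; rewrite ler_norml.
have := ler_norm (b x); have := ler_norm (- a x); rewrite normrN.
have := normr_ge0 (b x); have := normr_ge0 (a x); lra.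
Qed.

Lemma integrable_funeposneg d (X : measurableType d) (R : realType)
    (mu : {measure set X -> \bar R}) (f : X -> R) :
  measurable_fun setT f ->
  (\int[mu]_x (EFin \o f)^\+ x < +oo)%E -> (\int[mu]_x (EFin \o f)^\- x < +oo)%E ->
  mu.-integrable setT (EFin \o f).
Proof.
move=> /measurable_EFinP mf fp fn; apply/integrableP; split=> //.
rewrite -/(abse \o (EFin \o f)) fune_abse ge0_integralD//.
- exact: lte_add_pinfty.
- exact: measurable_funepos.
- exact: measurable_funeneg.
Qed.

Lemma integrable_ubound d (X : measurableType d) (R : realType)
    (mu : {measure set X -> \bar R}) (f b : X -> R) :
  measurable_fun setT f -> (forall x, f x <= b x) ->
  mu.-integrable setT (EFin \o b) -> (\int[mu]_x (f x)%:E)%E != -oo%E ->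
  mu.-integrable setT (EFin \o f).
Proof.
move=> mf fb intb fNy.
have mf' : measurable_fun setT (EFin \o f) by exact/measurable_EFinP.
have fp : (\int[mu]_x (EFin \o f)^\+ x < +oo)%E.
  apply: le_lt_trans (integral_funepos_lt_pinfty measurableT intb).
  apply: ge0_le_integral => //.
  - exact: measurable_funepos.
  - by apply: measurable_funepos; exact: measurable_int intb.
  - move=> x _; apply: (@funepos_le _ _ setT (EFin \o f) (EFin \o b)); last exact: in_setT.
    by move=> y _; rewrite lee_fin.
apply: integrable_funeposneg => //; rewrite ltey; apply: contra fNy => /eqP fn.
rewrite integralE fn.
by have := fp; case: (integral _ _ _).
Qed.

Section coboundary.
Context d (X : measurableType d) (R : realType) (mu : probability X R).
Variable tau : X -> X.
Hypotheses (mtau : measurable_fun setT tau)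
  (mu_tau : forall B, measurable B -> mu (tau @^-1` B) = mu B).

Let clamp (n : nat) (t : R) : R := Num.max (- n%:R) (Num.min n%:R t).

Let clamp_dist n s t : `|clamp n s - clamp n t| <= `|s - t|.
Proof.
have n0 : 0 <= n%:R :> R by [].
rewrite /clamp /Order.max /Order.min.
case: (ltP n%:R s) => ?; case: (ltP n%:R t) => ?; do ?case: (ltP (- _) _) => ?;
  by rewrite !ler_norml; case: (ler0P (s - t)) => ?; lra.
Qed.

Let clamp_diff n s t k : s - t <= k -> clamp n s - clamp n t <= `|k|.
Proof.
have n0 : 0 <= n%:R :> R by [].
rewrite /clamp /Order.max /Order.min.
case: (ltP n%:R s) => ?; case: (ltP n%:R t) => ?; do ?case: (ltP (- _) _) => ?;
  by move=> ?; case: (ler0P k) => ?; lra.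
Qed.

Let clamp_bound n t : `|clamp n t| <= n%:R.
Proof.
have n0 : 0 <= n%:R :> R by [].
rewrite /clamp /Order.max /Order.min.
by case: (ltP n%:R t) => ?; case: (ltP (- _) _) => ?; rewrite ler_norml; lra.
Qed.

Let clamp_cvg t : clamp n t @[n --> \oo] --> t.
Proof.
apply: cvg_near_cst; near=> n; rewrite /clamp.
have /ler_normlP[tn1 tn2] : `|t| <= n%:R by near: n; exact: nbhs_infty_ger.
by rewrite min_r// max_r// lerNl.
Unshelve. all: by end_near. Qed.

Let limn_einfE (u : (\bar R)^nat) l : u n @[n --> \oo] --> l -> limn_einf u = l.
Proof.
by move=> ul; rewrite is_cvg_limn_einfE; [exact: cvg_lim|apply/cvg_ex; exists l].
Qed.

Lemma integral_invariant (f : X -> R) : mu.-integrable setT (EFin \o f) ->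
  mu.-integrable setT (EFin \o f \o tau) ->
  (\int[mu]_x (f (tau x))%:E = \int[mu]_x (f x)%:E)%E.
Proof.
move=> intf intft.
transitivity (\int[pushforward mu tau]_x (f x)%:E)%E.
  by rewrite integral_pushforward//; exact: measurable_int intf.
by apply: eq_measure_integral => B mB _; exact: mu_tau.
Qed.

(** Truncating [f] to [-n, n] gives bounded coboundaries, which have integral 0;
    truncation is monotone and 1-Lipschitz, so they are still bounded by [`|k|]
    on one side and by [`|f - f \o tau|] in absolute value.  Fatou's lemma with the
    one-sided bound shows that [f - f \o tau] is integrable, and then dominated
    convergence gives its integral. *)
Lemma integral_coboundary (f k : X -> R) :
  measurable_fun setT f -> mu.-integrable setT (EFin \o k) ->
  (forall x, f x - f (tau x) <= k x) ->
  mu.-integrable setT (EFin \o (fun x => f x - f (tau x))) /\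
  (\int[mu]_x (f x - f (tau x))%:E = 0)%E.
Proof.
move=> mf intk fk.
pose D x := f x - f (tau x).
have mft : measurable_fun setT (f \o tau) by exact: measurableT_comp.
have mD : measurable_fun setT D by exact: measurable_funB.
have mk : measurable_fun setT k by apply/measurable_EFinP; exact: measurable_int intk.
have mclamp n (g : X -> R) : measurable_fun setT g -> measurable_fun setT (clamp n \o g).
  move=> mg; apply: measurable_maxr => //; exact: measurable_minr.
have intclamp n (g : X -> R) : measurable_fun setT g ->
    mu.-integrable setT (EFin \o (clamp n \o g)).
  move=> mg; apply: measurable_bounded_integrable => //.
  - by rewrite ltey_eq fin_num_measure.
  - exact: mclamp.
  - by exists n%:R; split=> // M /ltW nM x _; exact: le_trans (clamp_bound _ _) nM.
pose Dn n x := clamp n (f x) - clamp n (f (tau x)).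
have intDn n : mu.-integrable setT (EFin \o Dn n).
  have := integrableB measurableT (intclamp n _ mf) (intclamp n _ mft).
  exact: eq_integrable.
have Dn0 n : (\int[mu]_x (Dn n x)%:E = 0)%E.
  rewrite (integralB_EFin measurableT (intclamp n _ mf) (intclamp n _ mft)).
  rewrite (integral_invariant (intclamp n _ mf) (intclamp n _ mft)) subee//.
  exact/integrable_fin_num/intclamp.
have Dn_cvg x : Dn n x @[n --> \oo] --> D x by apply: cvgB; exact: clamp_cvg.
have intD : mu.-integrable setT (EFin \o D).
  have intk' : mu.-integrable setT (EFin \o (fun x => `|k x|)) by exact: integrable_norm.
  suff : mu.-integrable setT (EFin \o (fun x => `|k x| - D x)).
    move=> intkD; have := integrableB measurableT intk' intkD.
    by apply: eq_integrable => //; move=> x _ /=; rewrite -EFinB; congr EFin; rewrite /D; ring.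
  have mkD : measurable_fun setT (fun x => `|k x| - D x).
    by apply: measurable_funB => //; exact: measurableT_comp.
  apply/integrableP; split; first exact/measurable_EFinP.
  have kD0 x : 0 <= `|k x| - D x.
    by rewrite subr_ge0 (le_trans (fk x))// ler_norm.
  under eq_integral do rewrite /= ger0_norm//.
  have int_kDn n : (\int[mu]_x (`|k x| - Dn n x)%:E = \int[mu]_x (`|k x|)%:E)%E.
    by rewrite (integralB_EFin measurableT intk' (intDn n)) Dn0 sube0.
  apply: (@le_lt_trans _ _ (\int[mu]_x (`|k x|)%:E)%E); last first.
    exact: integrable_lty intk'.
  have := @fatou _ _ _ mu _ measurableT (fun n x => (`|k x| - Dn n x)%:E).
  under eq_integral.
    move=> x _; rewrite (limn_einfE (l := (`|k x| - D x)%:E)); last first.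
      by apply: cvg_EFin; [exact: nearW|apply: cvgB; [exact: cvg_cst|exact: Dn_cvg]].
    over.
  move=> /= fatou_kD; apply: le_trans (fatou_kD _ _) _.
  - move=> n; apply/measurable_EFinP; apply: measurable_funB.
      exact: measurableT_comp.
    by apply/measurable_EFinP; exact: measurable_int (intDn n).
  - by move=> n x _; rewrite lee_fin subr_ge0; exact: clamp_diff.
  - under eq_fun do rewrite int_kDn.
    by rewrite (limn_einfE (cvg_cst _)).
split=> //.
have [|||//|//|_ _] := @dominated_convergence _ _ _ mu setT measurableT
  (fun n => EFin \o Dn n) (EFin \o D) (fun x => `|D x|%:E).
- by move=> n; exact: measurable_int (intDn n).
- exact/measurable_EFinP.
- by apply: aeW => x _; apply: cvg_EFin; [exact: nearW|exact: Dn_cvg].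
- exact: integrable_norm.
- by apply: aeW => x n _; rewrite /= lee_fin; exact: clamp_dist.
under eq_fun do rewrite /= Dn0.
by move=> /cvg_lim <-//; rewrite lim_cst.
Qed.

End coboundary.

(** * Borel measures and continuous functions *)

Lemma continuous_borel_measurable (R : realType) (X : ptopologicalType) (f : X -> R) :
  continuous f -> measurable_fun setT (f : borel X -> R).
Proof.
move=> /continuousP cf; apply: (measurability _ (RGenOpens.measurableE R)).
move=> _ [_ [a [b ->] <-]]; rewrite setTI; apply: sub_sigma_algebra.
exact/cf/interval_open.
Qed.

Lemma borel_continuous_measurable (X Y : ptopologicalType) (f : X -> Y) :
  continuous f -> measurable_fun setT (f : borel X -> borel Y).
Proof.
move=> /continuousP cf; apply: (@measurability _ _ (borel X) (borel Y) setT f (@open Y) erefl).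
by move=> _ [V oV <-]; rewrite setTI; apply: sub_sigma_algebra; exact: cf.
Qed.

Section borel_measure_unique.
Local Open Scope ereal_scope.
Context (R : realType) (X : normedModType R).

(** The functions min(1, n d(x, ~U)) increase to the indicator of [U], because the
    distance to the complement is positive on an open set. *)
Lemma open_approximation (U : set X) : open U -> exists f : nat -> X -> R,
  [/\ forall n, continuous (f n), forall n x, (0 <= f n x <= 1)%R,
      forall x, nondecreasing_seq (f ^~ x) &
      forall x, f n x @[n --> \oo] --> (\1_U x : R)].
Proof.
move=> oU; have [U0|/set0P[a Ua]] := eqVneq (~` U) set0.
  have -> : U = setT by rewrite -(setCK U) U0 setC0.
  exists (fun _ _ => 1%R); split=> [n|n x|x|x].
  - exact: cst_continuous.
  - by rewrite lexx ler01.
  - by move=> i j ij.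
  - by rewrite indicT; exact: cvg_cst.
have dfin x : edist_inf (~` U) x \is a fin_num.
  rewrite ge0_fin_numE ?edist_inf_ge0//.
  apply: (@le_lt_trans _ _ (edist (x, a))); first by apply: ereal_inf_lbound; exists a.
  rewrite -ge0_fin_numE ?edist_ge0//; apply/edist_finP.
  exists (`|x - a| + 1)%R; first by rewrite ltr_wpDl.
  by rewrite -ball_normE /= ltrDl.
pose dist x := fine (edist_inf (~` U) x).
have dist0 x : (0 <= dist x)%R by rewrite fine_ge0// edist_inf_ge0.
have dist_cont : continuous dist.
  by move=> x; apply: fine_cvg; rewrite fineK//; exact: edist_inf_continuous.
exists (fun n x => Num.min 1 (n%:R * dist x))%R; split.
- move=> n x; apply: (@continuous_min _ _ (cst 1%R) (fun x => n%:R * dist x)%R).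
    exact: cst_continuous.
  by apply: cvgM; [exact: cvg_cst|exact: dist_cont].
- by move=> n x; rewrite le_min ler01 ge_min lexx/= mulr_ge0.
- move=> x i j ij; rewrite le_min !ge_min lexx/= ler_wpM2r ?orbT//.
  by rewrite ler_nat.
move=> x; rewrite indicE; case: (boolP (x \in U)) => [/set_mem Ux|/negP nUx].
  have [e e0 xeU] : exists2 e : R, (0 < e)%R & ball x e `<=` U.
    by have /nbhs_ballP[e /= e0 ?] := open_nbhs_nbhs (conj oU Ux); exists e.
  have ed : (e <= dist x)%R.
    rewrite -lee_fin fineK//; apply: le_ereal_inf_tmp => _ [b nUb <-].
    rewrite leNgt; apply/negP => xbe; apply: nUb; apply: xeU.
    exact: (@edist_lt_ball R X _ (x, b)).
  apply: cvg_near_cst; near=> n; apply: min_l.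
  rewrite -ler_pdivrMr ?(lt_le_trans e0)// div1r.
  by near: n; exact: nbhs_infty_ger.
rewrite /dist edist_inf0/=; last by move=> Ux; apply: nUx; rewrite inE.
under eq_fun do rewrite mulr0 min_r ?ler01//.
exact: cvg_cst.
Unshelve. all: by end_near. Qed.

(** Open sets generate the Borel sets, are stable under intersection, and their
    measures are limits of integrals of continuous functions. *)
Lemma borel_measure_unique (m1 m2 : {measure set (borel X) -> \bar R}) :
  m1 setT < +oo ->
  (forall f : X -> R, continuous f -> (forall x, 0 <= f x <= 1)%R ->
    \int[m1]_x (f x)%:E = \int[m2]_x (f x)%:E) ->
  forall B, measurable B -> m1 B = m2 B.
Proof.
move=> m1fin m12.
apply: (@measure_unique _ R (borel X) (@open X) (fun=> setT) erefl) => //.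
- by move=> U V oU oV; exact: openI.
- by move=> _; exact: openT.
- by rewrite bigcup_const//; exists 0%N.
move=> U oU; have mU : measurable (U : set (borel X)) by exact: sub_sigma_algebra.
have [f [cf f01 ndf fU]] := open_approximation oU.
have key (m : {measure set (borel X) -> \bar R}) :
    m U = limn (fun n => \int[m]_x (f n x)%:E).
  rewrite -monotone_convergence//.
  - rewrite -[LHS]mul1e -integral_cst// integral_mkcond; apply: eq_integral => x _.
    rewrite patchE; apply/esym/cvg_lim => //.
    move: (fU x); rewrite indicE; case: ifPn => _ fx; apply: cvg_EFin => //;
    exact: nearW.
  - by move=> n; apply/measurable_EFinP; exact: continuous_borel_measurable.
  - by move=> n x _; rewrite lee_fin; case/andP: (f01 n x).
  - by move=> x _ i j ij; rewrite lee_fin; exact: ndf.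
by rewrite !key; congr (limn _); apply/funext => n; exact: m12.
Qed.

End borel_measure_unique.

Lemma measurable_ln_continuous (R : realType) (X : ptopologicalType) (u : X -> R) :
  continuous u -> measurable_fun setT (@ln R \o u : borel X -> R).
Proof.
move=> cu; have mu : measurable_fun setT (u : borel X -> R) by exact: continuous_borel_measurable.
by apply: measurableT_comp.
Qed.

(** * Averages over fibers *)

Lemma sequentially_continuous (R : realType) (X : normedModType R) (F : X -> R) :
  (forall (y : nat -> X) x, y n @[n --> \oo] --> x -> F (y n) @[n --> \oo] --> F x) ->
  continuous F.
Proof.
move=> seqF x; apply/cvgrPdist_lt => e e0; apply: contrapT => nearN.
have bad n : exists y, `|x - y| < n.+1%:R^-1 /\ e <= `|F x - F y|.
  apply: contrapT => /forallNP ok; apply: nearN.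
  have : \forall y \near x, `|x - y| < n.+1%:R^-1.
    by move: (@cvg_id _ (nbhs x)) => /cvgrPdist_lt; apply; rewrite invr_gt0.
  apply: filterS => y xy; rewrite ltNge; apply/negP => Fxy.
  by apply: (ok y).
have [y /all_and2[xy Fxy]] := choice bad.
have yx : y n @[n --> \oo] --> x.
  apply/cvgrPdist_lt => r r0; near=> n.
  apply: (lt_trans (xy n)); near: n.
  exact: near_infty_natSinv_lt (PosNum r0).
have /cvgrPdist_lt /(_ e e0) [N _ /(_ N (leqnn N))] /= := seqF _ _ yx.
by rewrite ltNge Fxy.
Unshelve. all: by end_near. Qed.

Lemma bounded_continuousP (R : realType) (X : completeNormedModType R) (u : X -> R) :
  bounded_continuous u <-> continuous u /\ exists M, forall x, `|u x| <= M.
Proof.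
split=> -[cu bu]; split=> //.
  have [M [_ uM]] := bu; exists (M + 1) => x.
  by apply: uM; rewrite // ltrDl.
have [M uM] := bu; exists M; split=> [|N /ltW MN x _]; first exact: num_real.
exact: le_trans (uM x) MN.
Qed.

Lemma bounded_continuous_cst (R : realType) (X : completeNormedModType R) (c : R) :
  bounded_continuous (fun _ : X => c).
Proof.
by apply/bounded_continuousP; split; [exact: cst_continuous|exists `|c|].
Qed.

Lemma bounded_continuousM (R : realType) (X : completeNormedModType R) (f g : X -> R) :
  bounded_continuous f -> bounded_continuous g ->
  bounded_continuous (fun x => f x * g x).
Proof.
move=> /bounded_continuousP[cf [M fM]] /bounded_continuousP[cg [N gN]].
apply/bounded_continuousP; split; first by move=> x; apply: cvgM; [exact: cf|exact: cg].
by exists (M * N) => x; rewrite normrM ler_pM.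
Qed.

Lemma bounded_continuous_comp (R : realType) (X : completeNormedModType R)
    (f : X -> R) (T : X -> X) :
  continuous T -> bounded_continuous f -> bounded_continuous (f \o T).
Proof.
move=> cT /bounded_continuousP[cf [M fM]]; apply/bounded_continuousP; split.
  by move=> x; apply: continuous_comp; [exact: cT|exact: cf].
by exists M => x; exact: fM.
Qed.

Section fiber_average.
Context (R : realType) (X : completeNormedModType R) (T : {linear X -> X}).
Variable nu : probability (borel (kerT T)) R.
Implicit Types (u : X -> R) (y : X).

Definition fiber_average u y : R := \int[nu]_z u (\val z + y).

Lemma fiber_measurable u y : continuous u ->
  measurable_fun setT (fun z : borel (kerT T) => u (\val z + y)).
Proof.
move=> cu; apply: (@continuous_borel_measurable R (kerT T)) => z.
have cval : {for z, continuous (\val : kerT T -> X)} by exact: initial_continuous.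
have cshift : {for \val z, continuous (fun x => u (x + y))}.
  apply: (@continuous_comp _ _ _ (fun x => x + y) u); last exact: cu.
  by apply: cvgD; [exact: cvg_id|exact: cvg_cst].
exact: (@continuous_comp _ _ _ _ _ _ cval cshift).
Qed.

Lemma fiber_integrable u y : bounded_continuous u ->
  nu.-integrable setT (EFin \o (fun z => u (\val z + y))).
Proof.
move=> /bounded_continuousP[cu [M uM]]; apply: measurable_bounded_integrable => //.
- by rewrite ltey_eq fin_num_measure.
- exact: fiber_measurable.
- by exists M; split=> [|N /ltW MN x _]; [exact: num_real|exact: le_trans (uM _) MN].
Qed.

Lemma fiber_average_continuous u : bounded_continuous u -> continuous (fiber_average u).
Proof.
move=> bu; have /bounded_continuousP[cu [M uM]] := bu.
apply: sequentially_continuous => y x yx.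
apply: fine_cvg; rewrite fineK; last exact/integrable_fin_num/fiber_integrable.
have [|||//|//|_ _] := @dominated_convergence _ _ _ nu setT measurableT
  (fun n => EFin \o (fun z => u (\val z + y n))) (EFin \o (fun z => u (\val z + x)))
  (EFin \o cst M).
- by move=> n; exact: measurable_int (fiber_integrable (y n) bu).
- exact: measurable_int (fiber_integrable x bu).
- apply: aeW => z _; apply: cvg_EFin; first exact: nearW.
  apply: continuous_cvg; first exact: cu.
  by apply: cvgD; [exact: cvg_cst|exact: yx].
- exact: finite_measure_integrable_cst.
- by apply: aeW => z n _; rewrite lee_fin.
by [].
Qed.

Lemma fiber_average_gt0 u y : bounded_continuous u -> (forall x, 0 < u x) ->
  0 < fiber_average u y.
Proof.
move=> bu u0; rewrite lt_neqAle Rintegral_ge0 ?andbT//; last by move=> z _; exact/ltW.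
apply/negP => /eqP/esym avg0.
have mu_y := measurable_int _ (fiber_integrable y bu).
have : (\int[nu]_z `|(u (\val z + y))%:E| = 0)%E.
  under eq_integral do rewrite gee0_abs ?lee_fin ?(ltW (u0 _))//.
  by rewrite -[LHS]fineK ?[fine _]avg0//; exact/integrable_fin_num/fiber_integrable.
move=> /(ae_eq_integral_abs _ measurableT mu_y)[N [mN N0 subN]].
have NT : N = setT.
  apply/seteqP; split=> // z _; apply: subN => /= /(_ Logic.I) [] uz0.
  by move: (u0 (\val z + y)); rewrite uz0 ltxx.
have nuN : (nu N = 1)%E by rewrite NT; exact: (probability_setT nu).
by have /eqP := etrans (esym nuN) N0; rewrite onee_eq0.
Qed.

End fiber_average.

(** * Duality for the Gibbs state *)

Lemma preimage_fiber (R : realType) (X : completeNormedModType R)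
    (T : {linear X -> X}) (v : X -> X) (z : kerT T) x :
  preimage_selection T v -> T (\val z + v x) = x.
Proof.
move=> [Tv _]; have Tz : T (\val z) = 0 := set_mem (valP z).
by rewrite linearD Tz add0r Tv.
Qed.

Section ruelle_gibbs.
Context (R : realType) (X : completeNormedModType R) (T : {linear X -> X}).
Hypothesis cT : continuous T.
Context (nu : probability (borel (kerT T)) R) (v : X -> X).
Hypothesis hv : preimage_selection T v.
Context (A psi : X -> R) (lambda : R).
Hypotheses (cA : continuous A) (ubA : has_ubound (range A))
  (bcpsi : bounded_continuous psi) (psi_gt0 : forall x, 0 < psi x).
Variable mu : probability (borel X) R.
Hypothesis dual : dual_fixed nu v (normalized_potential T A lambda psi) mu.

Local Notation L0 := (ruelle nu v (fun=> 0)).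
Local Notation Abar := (normalized_potential T A lambda psi).
Local Notation weight := (fun x => expR (A x) * psi x).

Lemma ruelle0E u x : L0 u x = fiber_average nu u (v x).
Proof. by apply: eq_Rintegral => z _; rewrite expR0 mul1r. Qed.

Lemma ruelle0_measurable u : bounded_continuous u ->
  measurable_fun setT (L0 u : borel X -> R).
Proof.
move=> bu; have -> : L0 u = fiber_average nu u \o v.
  by apply/funext => x; exact: ruelle0E.
have mavg : measurable_fun setT (fiber_average nu u : borel X -> R).
  by apply: continuous_borel_measurable; exact: fiber_average_continuous.
by have [_ mv] := hv; exact: measurableT_comp mavg mv.
Qed.

Lemma ruelle0_gt0 u x : bounded_continuous u -> (forall y, 0 < u y) -> 0 < L0 u x.
Proof. by move=> bu u0; rewrite ruelle0E; exact: fiber_average_gt0. Qed.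

Lemma bounded_continuous_weight : bounded_continuous weight.
Proof.
apply: bounded_continuousM => //; apply/bounded_continuousP; split.
  by move=> x; apply: continuous_comp; [exact: cA|exact: continuous_expR].
have [C AC] := ubA; exists (expR C) => x; rewrite ger0_norm ?expR_ge0// ler_expR.
by apply: AC; exists x.
Qed.

(** On the fiber over [x] the denominator [lambda * (psi \o T)] of exp(Abar) is
    constant.  This turns the possibly unbounded exp(Abar) into the bounded
    [weight]. *)
Let exp_normalized (z : kerT T) x : expR (Abar (\val z + v x)) =
  expR (- (ln (psi x) + ln lambda)) * weight (\val z + v x).
Proof.
rewrite /normalized_potential preimage_fiber // -[psi (_ + _) in RHS]lnK ?posrE//.
by rewrite -!expRD; congr expR; ring.
Qed.

Lemma ruelle_normalizedE phi x : bounded_continuous phi ->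
  ruelle nu v Abar phi x =
    expR (- (ln (psi x) + ln lambda)) * L0 (fun y => weight y * phi y) x.
Proof.
move=> bphi; rewrite ruelle0E /fiber_average -RintegralZl//; last first.
  exact: (fiber_integrable nu (v x) (bounded_continuousM bounded_continuous_weight bphi)).
by apply: eq_Rintegral => z _; rewrite exp_normalized -mulrA.
Qed.

Lemma ruelle_normalized_integrable phi x : bounded_continuous phi ->
  nu.-integrable setT (EFin \o
    (fun z => expR (Abar (\val z + v x)) * phi (\val z + v x))).
Proof.
move=> bphi; pose c := expR (- (ln (psi x) + ln lambda)).
have bc : bounded_continuous (fun y => c * (weight y * phi y)).
  apply: bounded_continuousM; first exact: bounded_continuous_cst.
  by apply: bounded_continuousM => //; exact: bounded_continuous_weight.
have := fiber_integrable nu (v x) bc.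
by apply: eq_integrable => // z _; rewrite /= exp_normalized !mulrA.
Qed.

Lemma ruelle_normalized_measurable phi : bounded_continuous phi ->
  measurable_fun setT (ruelle nu v Abar phi : borel X -> R).
Proof.
move=> bphi; rewrite (_ : ruelle _ _ _ _ = fun x =>
    expR (- (ln (psi x) + ln lambda)) * L0 (fun y => weight y * phi y) x).
  apply: measurable_funM.
    apply: measurableT_comp => //; apply: measurableT_comp => //.
    apply: measurable_funD => //; apply: measurableT_comp => //.
    by apply: continuous_borel_measurable; have [] := bcpsi.
  apply: ruelle0_measurable; apply: bounded_continuousM => //.
  exact: bounded_continuous_weight.
by apply/funext => x; exact: ruelle_normalizedE.
Qed.

Lemma ruelle_normalized_ge0 phi x : (forall y, 0 <= phi y) ->
  0 <= ruelle nu v Abar phi x.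
Proof. by move=> phi0; apply: Rintegral_ge0 => z _; rewrite mulr_ge0// expR_ge0. Qed.

(** As functions of [g], both sides are integrals against finite Borel measures;
    for [g] bounded continuous, [phi * (g \o T)] is bounded continuous and its
    image under the operator is [g] times that of [phi], because [T] is constant
    on fibers. *)
Lemma gibbs_duality phi (g : X -> R) :
  bounded_continuous phi -> (forall x, 0 <= phi x) ->
  measurable_fun setT (g : borel X -> R) -> (forall x, 0 <= g x) ->
  (\int[mu]_x (phi x * g (T x))%:E = \int[mu]_x (ruelle nu v Abar phi x * g x)%:E)%E.
Proof.
move=> bphi phi0 mg g0; have /bounded_continuousP[cphi [M phiM]] := bphi.
pose k : borel X -> R := ruelle nu v Abar phi.
have mT : measurable_fun setT (T : borel X -> borel X).
  exact: borel_continuous_measurable.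
have mphi : measurable_fun setT (phi : borel X -> R) by exact: continuous_borel_measurable.
have mk : measurable_fun setT k by exact: ruelle_normalized_measurable.
have k0 x : 0 <= k x by exact: ruelle_normalized_ge0.
rewrite -(integral_weighted_pushforward mu mT mphi phi0 mg g0).
rewrite -(integral_weighted_pushforward mu (@measurable_id _ (borel X) setT) mk k0 mg g0).
apply: eq_measure_integral => B mB _.
apply: borel_measure_unique => //.
  rewrite /= /weighted_pushforward preimage_setT.
  apply: (@le_lt_trans _ _ (\int[mu]_x (cst M%:E) x)%E).
    apply: ge0_le_integral => //.
    - by move=> x _; rewrite lee_fin.
    - exact/measurable_EFinP.
    - by move=> x _; rewrite lee_fin (le_trans _ (phiM x))// ler_norm.
  by rewrite integral_cst// [X in (_ * X)%E](probability_setT mu) mule1 ltry.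
move=> f cf f01.
have f0 x : 0 <= f x by case/andP: (f01 x).
have mf : measurable_fun setT (f : borel X -> R) by exact: continuous_borel_measurable.
have bf : bounded_continuous f.
  apply/bounded_continuousP; split=> //; exists 1 => x.
  by rewrite ger0_norm//; case/andP: (f01 x).
rewrite (integral_weighted_pushforward mu mT mphi phi0 mf f0).
rewrite (integral_weighted_pushforward mu (@measurable_id _ (borel X) setT) mk k0 mf f0).
have bphif : bounded_continuous (fun x => phi x * f (T x)).
  by apply: bounded_continuousM => //; exact: bounded_continuous_comp.
rewrite (dual bphif); apply: eq_integral => x _; congr EFin.
rewrite /k /ruelle mulrC -RintegralZl//; last exact: ruelle_normalized_integrable.
by apply: eq_Rintegral => z _; rewrite preimage_fiber //; ring.
Qed.

(** The integrand is [(s / weight) * (g \o T)] with [g = lambda psi / L0 s].  By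
    duality its integral is that of [g * (L0 s / (lambda psi)) = 1]; as
    [s / weight] may be unbounded, it is truncated at level [n]; the bound by 1
    holds for each [n] and passes to the limit. *)
Lemma integral_exp_normalized_le1 s : bounded_continuous s -> (forall x, 0 < s x) ->
  (\int[mu]_x (expR (ln (s x) - Abar x - ln (L0 s (T x))))%:E <= 1)%E.
Proof.
move=> bs s0; have /bounded_continuousP[cs [M sM]] := bs.
have cw : continuous weight by have [] := bounded_continuous_weight.
have w0 x : 0 < weight x by rewrite mulr_gt0// expR_gt0.
have S0 x : 0 < L0 s x by exact: ruelle0_gt0.
pose q x := s x / weight x.
have q0 x : 0 < q x by rewrite divr_gt0.
have cq : continuous q.
  by move=> x; apply: cvgM; [exact: cs|apply: cvgV; [exact: lt0r_neq0|exact: cw]].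
pose phi n x := Num.min n%:R (q x).
have phi0 n x : 0 <= phi n x by rewrite le_min ler0n ltW.
have bphi n : bounded_continuous (phi n).
  apply/bounded_continuousP; split.
    by move=> x; apply: (@continuous_min R X (fun=> n%:R) q); [exact: cvg_cst|exact: cq].
  by exists n%:R => x; rewrite ger0_norm// ge_min lexx.
pose g x := expR (ln (psi x) + ln lambda - ln (L0 s x)).
have g0 x : 0 <= g x by exact: expR_ge0.
have mg : measurable_fun setT (g : borel X -> R).
  apply: measurableT_comp => //; apply: measurable_funB.
    apply: measurable_funD => //; apply: measurableT_comp => //.
    by apply: continuous_borel_measurable; have [] := bcpsi.
  by apply: measurableT_comp => //; exact: ruelle0_measurable.
have mgT : measurable_fun setT (g \o T : borel X -> R).
  have mT : measurable_fun setT (T : borel X -> borel X) by exact: borel_continuous_measurable.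
  exact: measurableT_comp mg mT.
have le1 n : (\int[mu]_x (phi n x * g (T x))%:E <= 1)%E.
  rewrite (gibbs_duality (bphi n) (phi0 n) mg g0).
  rewrite -(probability_setT mu) -[leRHS]mul1e -integral_cst//.
  apply: ge0_le_integral => //.
  - by move=> x _; rewrite lee_fin mulr_ge0// ruelle_normalized_ge0.
  - apply/measurable_EFinP; apply: measurable_funM => //.
    exact: ruelle_normalized_measurable.
  move=> x _; rewrite lee_fin ruelle_normalizedE// /g mulrAC -expRD.
  rewrite (_ : _ + _ = - ln (L0 s x)); last by ring.
  rewrite expRN lnK ?posrE// mulrC ler_pdivrMr// mul1r !ruelle0E.
  apply: le_Rintegral => //.
  - exact: (fiber_integrable nu (v x) (bounded_continuousM bounded_continuous_weight (bphi n))).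
  - exact: (fiber_integrable nu (v x) bs).
  - move=> z _; rewrite mulrC -ler_pdivlMr//.
    by rewrite ge_min lexx orbT.
have mphig n : measurable_fun setT (fun x : borel X => (phi n x * g (T x))%:E).
  apply/measurable_EFinP; apply: measurable_funM => //.
  by apply: continuous_borel_measurable; have [] := bphi n.
have phig0 n x : (0 <= (phi n x * g (T x))%:E)%E by rewrite lee_fin mulr_ge0.
have ndphig x : nondecreasing_seq (fun n => (phi n x * g (T x))%:E).
  move=> i j ij; rewrite lee_fin ler_wpM2r// le_min !ge_min lexx orbT andbT.
  by rewrite ler_nat ij.
have -> : (\int[mu]_x (expR (ln (s x) - Abar x - ln (L0 s (T x))))%:E =
    \int[mu]_x limn (fun n => (phi n x * g (T x))%:E))%E.
  apply: eq_integral => x _; apply/esym/cvg_lim => //.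
  rewrite (_ : expR _ = q x * g (T x)); last first.
    have -> : q x = expR (ln (s x) - A x - ln (psi x)).
      by rewrite !expRB !lnK ?posrE// /q invfM mulrA.
    by rewrite -expRD; congr expR; rewrite /normalized_potential; ring.
  apply: cvg_near_cst; near=> n; rewrite /phi min_r//.
  by near: n; exact: nbhs_infty_ger.
rewrite monotone_convergence//.
apply: lime_le; last exact: nearW.
apply: ereal_nondecreasing_is_cvgn => i j ij; apply: ge0_le_integral => //.
by move=> x _; exact: ndphig.
Unshelve. all: by end_near. Qed.

(** * Entropy bounds *)

Let mT : measurable_fun setT (T : borel X -> borel X).
Proof. exact: borel_continuous_measurable. Qed.

Let mlnpsi : measurable_fun setT (@ln R \o psi : borel X -> R).
Proof. by apply: measurable_ln_continuous; have [] := bcpsi. Qed.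

Let mA : measurable_fun setT (A : borel X -> R).
Proof. exact: continuous_borel_measurable. Qed.

Let mAbar : measurable_fun setT (Abar : borel X -> R).
Proof.
apply: measurable_funB => //; apply: measurable_funB.
  by apply: measurable_funD.
exact: measurableT_comp mlnpsi mT.
Qed.

Lemma measurable_ln_ruelle0 u : bounded_continuous u ->
  measurable_fun setT (@ln R \o L0 u : borel X -> R).
Proof.
move=> bu; have mS := ruelle0_measurable bu.
by apply: measurableT_comp.
Qed.

Lemma log_ratioE u x : bounded_continuous u -> (forall y, 0 < u y) ->
  log_ratio nu v u x = ln (L0 u x) - ln (u x).
Proof.
by move=> bu u0; rewrite /log_ratio ln_div ?posrE//; exact: ruelle0_gt0.
Qed.

Lemma log_ratio_measurable u : bounded_continuous u -> (forall y, 0 < u y) ->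
  measurable_fun setT (log_ratio nu v u : borel X -> R).
Proof.
move=> bu u0; rewrite (_ : log_ratio _ _ _ = (@ln R \o L0 u) \- (@ln R \o u)).
  apply: measurable_funB; first exact: measurable_ln_ruelle0.
  by apply: measurable_ln_continuous; have [] := bu.
by apply/funext => x; exact: log_ratioE.
Qed.

(** The test function [weight] satisfies [L0 weight = lambda psi], so its
    [log_ratio] is [ln lambda - A]. *)
Lemma entropy_add_le (m : probability (borel X) R) :
  (forall x, ruelle nu v A psi x = lambda * psi x) -> 0 < lambda ->
  (entropy nu v m + \int[m]_x (A x)%:E <= (ln lambda)%:E)%E.
Proof.
move=> eig lambda0; have [C A_le] := ubA.
have {}A_le x : A x <= C by apply: A_le; exists x.
have bw := bounded_continuous_weight.
have w0 x : 0 < weight x by rewrite mulr_gt0// expR_gt0.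
have ratioE : log_ratio nu v weight = fun x => ln lambda - A x.
  apply/funext => x; rewrite log_ratioE// (_ : L0 weight x = lambda * psi x).
    by rewrite !lnM ?posrE ?expR_gt0// expRK; ring.
  by rewrite -eig; apply: eq_Rintegral => z _; rewrite expR0 mul1r.
(* If the integral of A is -oo then the sum is -oo, whatever the entropy is. *)
have [Aoo|Aoo] := eqVneq (\int[m]_x (A x)%:E)%E -oo%E.
  by rewrite Aoo addeNy leNye.
have intcst c : m.-integrable setT (EFin \o (fun=> c : R)).
  exact: finite_measure_integrable_cst.
have AlnC : (ln lambda)%:E = (\int[m]_x (ln lambda)%:E)%E.
  by rewrite integral_cst// [X in (_ * X)%E](probability_setT m) mule1.
have intA := integrable_ubound mA A_le (intcst C) Aoo.
have -> : (ln lambda = ln lambda - fine (\int[m]_x (A x)%:E) +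
    fine (\int[m]_x (A x)%:E))%R by ring.
rewrite -[X in (_ + X)%E]fineK ?integrable_fin_num// EFinD leeD2r// EFinB.
rewrite fineK ?integrable_fin_num// AlnC -integralB_EFin//.
apply: ereal_inf_lbound; exists weight; last first.
  by apply: eq_integral => x _; rewrite ratioE.
split=> //; right; rewrite ratioE.
by apply: integral_funeneg_lt_pinfty => //; exact: (integrableB measurableT (intcst _) intA).
Qed.

Hypothesis mu_inv : invariant_probability T mu.

(** exp(- G_u) for the function G_u = log(L_0 u) o T - log u + Abar. *)
Let expo u x := expR (ln (u x) - Abar x - ln (L0 u (T x))).

Let expo_measurable u : bounded_continuous u ->
  measurable_fun setT (expo u : borel X -> R).
Proof.
move=> bu; apply: measurableT_comp => //; apply: measurable_funB.
  apply: measurable_funB; last exact: mAbar.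
  by apply: measurable_ln_continuous; have [] := bu.
exact: measurableT_comp (measurable_ln_ruelle0 bu) mT.
Qed.

Let expo_integrable u : bounded_continuous u -> (forall x, 0 < u x) ->
  mu.-integrable setT (EFin \o expo u).
Proof.
move=> bu u0; have me := expo_measurable bu.
apply/integrableP; split; first exact/measurable_EFinP.
under eq_integral do rewrite /= ger0_norm ?expR_ge0//.
apply: le_lt_trans (ltry 1).
exact: integral_exp_normalized_le1.
Qed.

Let ruelle0_psiT x : L0 (psi \o T) x = psi x.
Proof.
transitivity (\int[nu]_(z in setT) psi x).
  apply: eq_Rintegral => z _; rewrite /= expR0 mul1r.
  by rewrite preimage_fiber.
by rewrite Rintegral_cst// [X in fine X](probability_setT nu) mulr1.
Qed.

Let intcst c : mu.-integrable setT (EFin \o (fun=> c : R)).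
Proof. exact: finite_measure_integrable_cst. Qed.

Let D x := ln (psi (T x)) - ln (psi x).

(** Here [exp(- Abar)] is [expo (psi \o T)], because [L0 (psi \o T) = psi]; and
    [D = A - ln lambda - Abar] is at most a constant plus [exp(- Abar)]. *)
Let intD : mu.-integrable setT (EFin \o D) /\ (\int[mu]_x (D x)%:E = 0)%E.
Proof.
have [C A_le] := ubA; have {}A_le x : A x <= C by apply: A_le; exists x.
have bpsiT : bounded_continuous (psi \o T) by exact: bounded_continuous_comp.
have inte := expo_integrable bpsiT (fun x => psi_gt0 (T x)).
have intk := integrableD measurableT (intcst (C - ln lambda - 1)) inte.
have mf : measurable_fun setT (fun x : borel X => - ln (psi x)).
  exact: measurableT_comp mlnpsi.
have [x|int0 eq0] := integral_coboundary mT mu_inv mf intk.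
  rewrite /expo ruelle0_psiT /=.
  have := expR_ge1Dx (ln (psi (T x)) - Abar x - ln (psi (T x))).
  have := A_le x; rewrite /normalized_potential; lra.
have DE x : D x = - ln (psi x) - - ln (psi (T x)) by rewrite /D; ring.
split.
  by apply: eq_integrable int0 => // x _; rewrite /= DE.
by rewrite -[RHS]eq0; apply: eq_integral => x _; rewrite DE.
Qed.

(** Since [Abar >= 1 - exp(- Abar)], the identity [A = Abar + D + ln lambda] bounds
    [A] from below by an integrable function. *)
Lemma gibbs_potential_integrable : mu.-integrable setT (EFin \o A).
Proof.
have [C A_le] := ubA; have {}A_le x : A x <= C by apply: A_le; exists x.
have bpsiT : bounded_continuous (psi \o T) by exact: bounded_continuous_comp.
have inte := expo_integrable bpsiT (fun x => psi_gt0 (T x)).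
pose a x := 1 + ln lambda + D x - expo (psi \o T) x.
have inta : mu.-integrable setT (EFin \o a) :=
  integrableB measurableT (integrableD measurableT (intcst _) intD.1) inte.
apply: (@integrable_between _ _ _ mu a A (fun=> C)) => //; rewrite /a.
move=> x; rewrite A_le andbT /expo ruelle0_psiT /=.
have := expR_ge1Dx (ln (psi (T x)) - Abar x - ln (psi (T x))).
rewrite {1}/normalized_potential /D; lra.
Qed.

Let intAbar : mu.-integrable setT (EFin \o Abar).
Proof.
have := integrableB measurableT (integrableB measurableT gibbs_potential_integrable intD.1)
  (intcst (ln lambda)).
apply: eq_integrable => // x _ /=; congr EFin.
by rewrite /D /normalized_potential; ring.
Qed.

Let int_Abar : Rintegral mu setT Abar = Rintegral mu setT A - ln lambda.
Proof.
transitivity (\int[mu]_x (A x - D x - ln lambda)).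
  by apply: eq_Rintegral => x _; rewrite /D /normalized_potential; ring.
rewrite RintegralB//; last exact: (integrableB measurableT gibbs_potential_integrable intD.1).
rewrite RintegralB//; last 2 first.
- exact: gibbs_potential_integrable.
- exact: intD.1.
rewrite Rintegral_cst// [X in fine X](probability_setT mu) mulr1.
by rewrite [X in _ - X - _]/Rintegral intD.2 subr0.
Qed.

(** With [f = ln \o L0 u], [log_ratio u = (f - f \o T) + G_u - Abar] and
    [G_u >= 1 - expo u]. *)
Lemma gibbs_log_ratio_ge u : bounded_continuous u -> (forall x, 0 < u x) ->
  integral_exists mu (log_ratio nu v u) ->
  ((ln lambda)%:E - \int[mu]_x (A x)%:E <= \int[mu]_x (log_ratio nu v u x)%:E)%E.
Proof.
move=> bu u0 exu; have mF := log_ratio_measurable bu u0.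
pose F : borel X -> R := log_ratio nu v u.
have FE x : F x = ln (L0 u x) - ln (u x) by exact: log_ratioE.
(* If the positive part has an infinite integral, the negative part has a finite
   one, so the integral of the log-ratio is +oo. *)
have [Foo|Fpos] := eqVneq (\int[mu]_x (EFin \o F)^\+ x)%E +oo%E.
  have Fneg : (\int[mu]_x (EFin \o F)^\- x < +oo)%E.
    by case: exu => //; rewrite -/F Foo ltxx.
  rewrite [leRHS]integralE Foo addye ?leey//.
  by move: Fneg; case: (integral _ _ _).
pose Fp x := Num.max (F x) 0.
have mFp : measurable_fun setT Fp by exact: measurable_maxr.
have intFp : mu.-integrable setT (EFin \o Fp).
  apply/integrableP; split; first exact/measurable_EFinP.
  move: Fpos; rewrite -ltey; apply: le_lt_trans; rewrite le_eqVlt; apply/orP; left.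
  apply/eqP; apply: eq_integral => x _; rewrite funeposE /Fp /=.
  by rewrite ger0_norm ?EFin_max// le_max lexx orbT.
have inte := expo_integrable bu u0.
have exp1 x : 1 - expo u x <= Abar x + ln (L0 u (T x)) - ln (u x).
  have := expR_ge1Dx (ln (u x) - Abar x - ln (L0 u (T x))); rewrite /expo; lra.
have intk := integrableD measurableT (integrableD measurableT intFp inte) intAbar.
have [x|intf intf0] := integral_coboundary mT mu_inv
    (measurable_ln_ruelle0 bu) intk.
  have := exp1 x; rewrite /= /Fp FE; have : F x <= Num.max (F x) 0 by rewrite le_max lexx.
  rewrite FE; lra.
pose f x := ln (L0 u x) - ln (L0 u (T x)).
pose a x := f x + 1 - expo u x - Abar x.
have inta1 := integrableB measurableT (integrableD measurableT intf (intcst 1)) inte.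
have inta : mu.-integrable setT (EFin \o a) := integrableB measurableT inta1 intAbar.
have aF x : a x <= F x by have := exp1 x; rewrite FE /a /f; lra.
have intF : mu.-integrable setT (EFin \o F).
  apply: integrable_between inta intFp => //.
  by move=> x; rewrite aF /= le_max lexx.
apply: (@le_trans _ _ (\int[mu]_x (a x)%:E)%E); last first.
  by apply: le_integral => // x _; rewrite lee_fin.
rewrite -[X in (_ - X)%E]fineK; last exact/integrable_fin_num/gibbs_potential_integrable.
rewrite -[leRHS]fineK; last exact/integrable_fin_num.
rewrite -EFinB lee_fin -!/(Rintegral _ _ _).
rewrite RintegralB// RintegralB//; last exact: (integrableD measurableT intf (intcst 1)).
rewrite RintegralD// Rintegral_cst// [X in fine X](probability_setT mu) mulr1.
rewrite int_Abar [X in X + _ - _ - _]/Rintegral intf0 /=.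
suff : Rintegral mu setT (expo u) <= 1 by rewrite /Rintegral; lra.
rewrite -lee_fin /Rintegral fineK; last exact/integrable_fin_num.
exact: integral_exp_normalized_le1.
Qed.

End ruelle_gibbs.

Unset Implicit Arguments.
Set Strict Implicit.
Set Printing Implicit Defensive.

Theorem theorem1 (R : realType) (X : completeNormedModType R)
  (hX : separable_space X)
  (T : {linear X -> X}) (hTbounded : bounded_near T (nbhs (0 : X)))
  (hTsurj : forall y, exists x, T x = y) (hTbij : ~ bijective T)
  (hker : exists d : nat, (0 < d)%N /\ has_dim (ker_pow T 1) d)
  (E : nat -> set X)
  (hdec : forall n, (0 < n)%N -> direct_sum_decomposition (ker_pow T n) (E n))
  (hTE : forall n, (0 < n)%N -> T @` E n.+1 `<=` E n)
  (alpha : R) (halpha : 0 < alpha <= 1)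
  (hp : summable_p_pow T E alpha)
  (nu : probability (borel (kerT T)) R)
  (hsupp : full_support nu) (htails : strong_adapted_tails E nu)
  (v : X -> X) (hv : preimage_selection T v)
  (A : X -> R) (hAub : has_ubound (range A))
  (hAhol : hoelder_fun alpha A) (hAsv : summable_variations T E A)
  (lambda : R) (psi : X -> R) (hpsi : main_eigenpair nu v alpha A lambda psi)
  (mu : probability (borel X) R) (hmu : gibbs_state nu v A lambda psi mu) :
  [/\ pressure nu v A = (ln lambda)%:E,
      (ln lambda)%:E = (entropy nu v mu + \int[mu]_x (A x)%:E)%E &
      equilibrium_state nu v A mu].
Proof.
have [lambda0 [[cpsi _] bpsi] psi0 eig] := hpsi.
have [cA _] := hAsv; have [mu_inv dual] := hmu.
have cT : continuous T by exact: bounded_linear_continuous.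
have bcpsi : bounded_continuous psi by [].
have mu_le m := entropy_add_le cA hAub bcpsi psi0 m eig lambda0.
have intA := gibbs_potential_integrable cT hv cA hAub bcpsi psi0 dual mu_inv.
have Afin : (\int[mu]_x (A x)%:E)%E \is a fin_num by exact: integrable_fin_num.
have muE : (ln lambda)%:E = (entropy nu v mu + \int[mu]_x (A x)%:E)%E.
  apply/eqP; rewrite eq_le mu_le andbT -leeBlDr//.
  apply: le_ereal_inf_tmp => _ [u [bu u0 exu] <-].
  exact: (gibbs_log_ratio_ge cT hv cA hAub bcpsi psi0 dual mu_inv bu u0 exu).
have pressureE : pressure nu v A = (ln lambda)%:E.
  apply/eqP; rewrite eq_le; apply/andP; split.
    by apply: ge_ereal_sup => _ [m _ <-]; exact: mu_le.
  by rewrite muE; apply: ereal_sup_ubound; exists mu.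
by split=> //; split=> //; rewrite pressureE.
Qed.
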